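(* Let $q\in\mathbb{T}\setminus\{1\}$, let $(S,T)$ be a $q$-commuting pair on a Hilbert space $H$, let $\alpha\neq0$ be an eigenvalue of $S$, let $q^i\neq1$ for $i=1,\dots,n-1$, and suppose that, with respect to the decomposition of $H$ into the generalized eigenspaces $H_{S,\alpha},H_{S,q\alpha},\dots,H_{S,q^{n-1}\alpha}$, $$S=\mathrm{diag}(J_{S,\alpha},J_{S,q\alpha},\dots,J_{S,q^{n-1}\alpha}).$$ (1) If $q^n\neq1$, then neither $\bar q\alpha$ nor $q^n\alpha$ is an eigenvalue of $S$, and $T$ has the block form in which the only possibly nonzero blocks are the subdiagonal ones: $$T=\begin{pmatrix}0&\cdots&\cdots&0\\ T_1&\ddots&&\vdots\\ &\ddots&\ddots&\vdots\\ 0&&T_{n-1}&0\end{pmatrix},\qquad T_i:H_{S,q^{i-1}\alpha}\to H_{S,q^i\alpha}\ (i=1,\dots,n-1).$$ (2) If $q^n=1$, then $T$ has the more general form $$T=\begin{pmatrix}0&\cdots&0&T_n\\ T_1&\ddots&&0\\ &\ddots&\ddots&\vdots\\ 0&&T_{n-1}&0\end{pmatrix},$$ with $T_i:H_{S,q^{i-1}\alpha}\to H_{S,q^i\alpha}$ for $i=1,\dots,n$ (where $q^n\alpha=\alpha$). If $T_i=0$, then we may reorder the Jordan parts of $S$ to $J_{S,q^i\alpha},\dots,J_{S,q^{n-1}\alpha},J_{S,\alpha},\dots,J_{S,q^{i-1}\alpha}$, and then $T_i=0$ is positioned in the upper right corner of the matrix of $T$. Moreover, suppose that for a given $i$ each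 of the eigenvalues $q^{i-1}\alpha$ and $q^i\alpha$ of $S$ has a unique Jordan block. Let $x_1,\dots,x_k$ be a Jordan basis of $H_{S,q^{i-1}\alpha}$ (so $(S-q^{i-1}\alpha I)x_1=0$ and $(S-q^{i-1}\alpha I)x_j=x_{j-1}$ for $j\ge2$), and let $0\le l\le k$ be the largest number such that $Tx_l=0$ (with $l=0$ if $Tx_1\neq0$). Then, taking the basis of $H_{S,q^i\alpha}$ consisting of a full sequence of generalized eigenvectors $$Tx_{l+1},\ \bar q\,Tx_{l+2},\ \dots,\ \bar q^{\,k-l-1}Tx_k,\ y_1,\dots,y_j,$$ we get the form $$T_i=\begin{pmatrix}0&\mathrm{diag}(1,q,\dots,q^{k-l-1})\\0&0\end{pmatrix},$$ where the $0$'s are zero matrices of the respective sizes. In particular, $\ker T_i=\{0\}$ if and only if $l=0$ and the matrix of $T_i$ is square, so that the corresponding Jordan blocks of $q^{i-1}\alpha$ and $q^i\alpha$ are of the same size.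
   Context: A pair $(S,T)$ of bounded operators on $H$ is $q$-commuting ($|q|=1$) if $ST=qTS$. For $\beta\in\mathbb{C}$, $H_{S,\beta}$ is the generalized eigenspace of $S$ for $\beta$ (spanned by the generalized eigenvectors, i.e. the vectors annihilated by some power of $S-\beta I$; it is $\{0\}$ if $\beta$ is not an eigenvalue), and $J_{S,\beta}$ is the part of the Jordan matrix of $S$ corresponding to $\beta$, possibly consisting of several Jordan blocks.
   Formalization: The last sentence is false as stated (T_i can be injective with a non-square matrix); proved instead: ker T_i = {0} iff l = 0, T_i is bijective iff l = 0 and its matrix is square, and a square matrix forces the two Jordan blocks to have the same size. *)

(* Defs.v *)
From HB Require Import structures.
From mathcomp Require Import all_boot all_order all_algebra.
From mathcomp Require Import sesquilinear complex.
From mathcomp Require Import all_classical all_reals all_analysis.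

Set Implicit Arguments.
Unset Strict Implicit.
Unset Printing Implicit Defensive.

Import Order.TTheory GRing.Theory Num.Theory.
Import numFieldNormedType.Exports.

Local Open Scope classical_set_scope.
Local Open Scope ring_scope.

Definition bounded_operator (K : numFieldType) (H : normedModType K)
    (A : H -> H) : Prop :=
  exists M : K, forall x, `|A x| <= M * `|x|.

Section LinearAlgebra.
Context {K : fieldType} {H : lmodType K}.
Implicit Types (S T : H -> H) (beta : K).

Definition is_eigenvalue S beta : Prop := exists2 x : H, x != 0 & S x = beta *: x.

(* The vectors annihilated by a power of [S - beta I] already form a linear
   subspace, so no span is taken. *)
Definition gen_eigenspace S beta : set H :=
  [set x | exists m : nat, iter m (fun y => S y - beta *: y) x = 0].

(* Basis of the subspace [V] in the algebraic sense (finite linear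
   combinations); the index type is finite or infinite. *)
Definition is_basis (I : choiceType) (V : set H) (v : I -> H) : Prop :=
  (forall i, V (v i)) /\
  forall x, V x -> exists! c : I -> K,
    finite_set [set i | c i != 0] /\ x = \sum_(i \in [set: I]) c i *: v i.

(* The sequence x_1, ..., x_k is indexed from 0: [x a] is x_(a+1). *)
Definition jordan_chain S beta (k : nat) (x : 'I_k -> H) : Prop :=
  (forall a : 'I_k, a = 0%N :> nat -> S (x a) - beta *: x a = 0) /\
  (forall a b : 'I_k, b = a.+1 :> nat -> S (x b) - beta *: x b = x a).

Definition jordan_chain_basis S beta (k : nat) (x : 'I_k -> H) : Prop :=
  jordan_chain S beta x /\ is_basis (gen_eigenspace S beta) x.

(* [l] is the largest number in 0..k with T x_l = 0, where x_0 = 0. *)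
Definition last_vanishing T (k : nat) (x : 'I_k -> H) (l : nat) : Prop :=
  [/\ (l <= k)%N,
      (forall a : 'I_k, a.+1 = l -> T (x a) = 0) &
      (forall a : 'I_k, (l < a.+1)%N -> T (x a) <> 0)].

(* The part J_{S,beta} of a Jordan matrix together with the basis vectors that
   it refers to: [jidx] indexes the Jordan blocks, [jlen b] is the size of the
   block [b] and [jvec b] its Jordan chain. *)
Record jordan_part := JordanPart {
  jidx : choiceType;
  jlen : jidx -> nat;
  jvec : forall b : jidx, 'I_(jlen b) -> H }.

Definition is_jordan_part S beta (J : jordan_part) : Prop :=
  [/\ (forall b : jidx J, (0 < jlen b)%N),
      (forall b : jidx J, jordan_chain S beta (@jvec J b)) &
      is_basis (gen_eigenspace S beta)
        (fun t : {b : jidx J & 'I_(jlen b)} => jvec (tagged t))].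

Definition only_block (J : jordan_part) (b : jidx J) : Prop :=
  forall b' : jidx J, b' = b.

(* Algebraic direct sum decomposition of [H]. *)
Definition decomposition (n : nat) (V : 'I_n -> set H) : Prop :=
  forall x, exists! u : 'I_n -> H, (forall a, V a (u a)) /\ x = \sum_a u a.

Definition component (n : nat) (V : 'I_n -> set H) (x : H) : 'I_n -> H :=
  xget (fun=> 0) [set u | (forall a, V a (u a)) /\ x = \sum_a u a].

(* Entry (a, b) of the block matrix of [A]: the map from [V b] to [V a] that
   sends [x] to the component of [A x] in [V a]. *)
Definition block (n : nat) (V : 'I_n -> set H) (A : H -> H) (a b : 'I_n) : H -> H :=
  fun x => component V (A x) a.

Definition block_zero (n : nat) (V : 'I_n -> set H) (A : H -> H) (a b : 'I_n) : Prop :=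
  forall x, V b x -> block V A a b x = 0.

(* [S = diag (J 0, ..., J (n-1))] with respect to the generalized eigenspaces
   of [S] for [lam 0, ..., lam (n-1)]. *)
Definition jordan_diag (n : nat) S (lam : 'I_n -> K) (J : 'I_n -> jordan_part) :
    Prop :=
  [/\ decomposition (fun a => gen_eigenspace S (lam a)),
      (forall a b, a != b ->
         block_zero (fun a => gen_eigenspace S (lam a)) S a b) &
      (forall a, is_jordan_part S (lam a) (J a))].

Definition is_matrix_of (k m : nat) (A : H -> H) (x : 'I_k -> H) (w : 'I_m -> H)
    (M : 'M[K]_(m, k)) : Prop :=
  forall c, A (x c) = \sum_r M r c *: w r.

End LinearAlgebra.

Arguments jordan_part {K} H.

Definition ord_rot (n i : nat) (a : 'I_n) : 'I_n :=
  Ordinal (ltn_pmod (i + a) (leq_ltn_trans (leq0n a) (ltn_ord a))).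

(* T x_(l+1), conj q T x_(l+2), ..., (conj q)^(p-1) T x_(l+p), y_1, ..., y_j *)
Definition image_chain (K : numClosedFieldType) (H : lmodType K) (q : K)
    (T : H -> H) (l p j : nat) (x : 'I_(l + p) -> H) (y : 'I_j -> H) :
    'I_(p + j) -> H :=
  fun r => match fintype.split r with
           | inl s => (q^* ) ^+ s *: T (x (rshift l s))
           | inr t => y t
           end.

(* The matrix with diag(1, q, ..., q^(p-1)) in the upper right corner and zero
   blocks elsewhere. *)
Definition corner_mx (K : fieldType) (q : K) (l p j : nat) : 'M[K]_(p + j, l + p) :=
  block_mx 0 (diag_mx (\row_(r < p) q ^+ r)) 0 0.

(* Main.v *)
Require Import Defs.
From HB Require Import structures.
From mathcomp Require Import all_boot all_order all_algebra.
From mathcomp Require Import sesquilinear complex.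
From mathcomp Require Import all_classical all_reals all_analysis.

Set Implicit Arguments.
Unset Strict Implicit.
Unset Printing Implicit Defensive.

Import Order.TTheory GRing.Theory Num.Theory.
Import numFieldNormedType.Exports.

Local Open Scope classical_set_scope.
Local Open Scope ring_scope.

(** Everything rests on the intertwining identity
      (S - q beta) T = q T (S - beta),
    which follows from S T = q T S and is [eigen_shift_intertwine] below.
    Iterating it, T maps the generalized eigenspace of S for beta into the one
    for q beta ([qcommute_gen_eigenspace]).  With respect to the
    decomposition, T thus has at most one nonzero block in each column: the
    block below the diagonal, and for the last column either the corner block,
    if q^n = 1, or none.  In the latter case q^n alpha differs from every
    eigenvalue in the decomposition, and an eigenvalue of S must occur there
    ([eigenvalue_in]: the components of an eigenvector are eigenvectors for the
    same eigenvalue, hence vanish unless it is the one of their summand).  So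
    the generalized eigenspace for q^n alpha is trivial and T kills the last
    summand.  The same argument excludes the eigenvalue conj q * alpha.  The
    reordering in the case q^n = 1 is a reindexing of the decomposition by a
    rotation of the indices, with which the cyclic successor commutes.

    For the matrix of T_i, put N = S - beta and N' = S - q beta.  A sequence f_0,
    ..., f_(k-1) with N f_0 = 0 and N f_(i+1) = f_i is a basis of the generalized
    kernel of N exactly when f_0 <> 0, ker N is contained in the line of f_0,
    and N^k annihilates the generalized kernel ([chain_basisP]).  These
    conditions, recorded as [full_chain], make dimension arguments unnecessary:
    they determine k, and a chain with nonzero first vector can be prolonged
    step by step, since N is onto ker N^r from ker N^(r+1) as long as r < k
    ([full_chain_extend]).  By the intertwining identity the vectors
    conj q^s T x_(l+1+s) form a chain for N' with nonzero first vector; prolonging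
    it gives y_1, ..., y_j.  The matrix of T_i is then read off.  A nonzero
    vector of ker T would be sent by a power of N to a nonzero multiple of x_1
    in ker T, so T_i is injective exactly when l = 0.  If T_i is onto, N'^k
    vanishes on the target for the length k of the source chain, so the target
    chain is not longer than the source chain. *)

(** * Generalized kernels and chains *)

Section Nilpotent.
Context {K : fieldType} {H : lmodType K}.

Definition gker (N : H -> H) : set H := [set x | exists m : nat, iter m N x = 0].

Section OneMap.
Variable N : {linear H -> H}.

Lemma iter_lin0 m : iter m N 0 = 0.
Proof. by elim: m => //= m ->; rewrite linear0. Qed.

Lemma iter_linD m x y : iter m N (x + y) = iter m N x + iter m N y.
Proof. by elim: m => //= m ->; rewrite linearD. Qed.

Lemma iter_linZ m a x : iter m N (a *: x) = a *: iter m N x.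
Proof. by elim: m => //= m ->; rewrite linearZ. Qed.

Lemma iter_lin_sum m (I : finType) (F : I -> H) :
  iter m N (\sum_i F i) = \sum_i iter m N (F i).
Proof.
exact: (big_morph (iter m N) (iter_linD m) (iter_lin0 m)).
Qed.

Lemma iter_lin_eq0 m m' x : (m <= m')%N -> iter m N x = 0 -> iter m' N x = 0.
Proof. by move=> le_mm' x0; rewrite -(subnK le_mm') iterD x0 iter_lin0. Qed.

Lemma gker0 : gker N 0.
Proof. by exists 0%N. Qed.

Lemma gkerD x y : gker N x -> gker N y -> gker N (x + y).
Proof.
move=> [m mx] [m' my]; exists (maxn m m'); rewrite iter_linD.
by rewrite (iter_lin_eq0 (leq_maxl _ _) mx) (iter_lin_eq0 (leq_maxr _ _) my) addr0.
Qed.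

Lemma gkerZ a x : gker N x -> gker N (a *: x).
Proof. by move=> [m mx]; exists m; rewrite iter_linZ mx scaler0. Qed.

Lemma gker_apply x : gker N x -> gker N (N x).
Proof. by move=> [m mx]; exists m; rewrite -iterSr iterS mx linear0. Qed.

Lemma gker_sum (I : finType) (F : I -> H) :
  (forall i, gker N (F i)) -> gker N (\sum_i F i).
Proof. by move=> FN; apply: big_ind => //; [exact: gker0|exact: gkerD]. Qed.

(** If a vector of [P] is annihilated by [N ^ m], then [N ^ (m - 1)] sends it
    into [ker N], still inside [P]: by descent on [m], the vectors of [P] in the
    generalized kernel vanish as soon as those in the kernel do. *)
Lemma gker_kernel (P : H -> Prop) :
  (forall x, P x -> P (N x)) -> (forall x, N x = 0 -> P x -> x = 0) ->
  forall x, gker N x -> P x -> x = 0.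
Proof.
move=> PN ker0 x [m]; elim: m x => [|m IHm] x //; rewrite iterSr => mNx Px.
by apply: ker0 => //; apply: IHm => //; apply: PN.
Qed.

(** Jordan chains are indexed by [nat], with only the first [k] values
    constrained, so that shifting, truncating and prolonging a chain need no
    change of index type. *)
Definition chain (k : nat) (f : nat -> H) : Prop :=
  forall i, (i < k)%N -> N (f i) = if i is i'.+1 then f i' else 0.

Lemma chain_iter k f m i : chain k f -> (i < k)%N ->
  iter m N (f i) = if (m <= i)%N then f (i - m)%N else 0.
Proof.
move=> fN; elim: m i => [|m IHm] [|i] lt_ik; rewrite ?subn0 // iterSr fN //.
  exact: iter_lin0.
by rewrite IHm ?subSS // ltnW.
Qed.

Lemma chain_gker k f i : chain k f -> (i < k)%N -> gker N (f i).
Proof. by move=> fN lt_ik; exists i.+1; rewrite (chain_iter _ fN) // ltnn. Qed.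

Lemma chain_free k f (c : nat -> K) : chain k f -> ((0 < k)%N -> f 0%N != 0) ->
  \sum_(i < k) c i *: f i = 0 -> forall i, (i < k)%N -> c i = 0.
Proof.
move=> fN f0 cf0 i lt_ik; apply/eqP; apply: contraT => ci.
have exP : exists i, (i < k)%N && (c i != 0) by exists i; rewrite lt_ik.
have ubP j : (j < k)%N && (c j != 0) -> (j <= k)%N by case/andP => /ltnW.
(* m is the largest index with a nonzero coefficient: N^m keeps only that term *)
case: (ex_maxnP exP ubP) => m /andP[lt_mk cm] max_m.
have := congr1 (iter m N) cf0; rewrite iter_lin0 iter_lin_sum.
rewrite (bigD1 (Ordinal lt_mk)) //= iter_linZ (chain_iter _ fN) // leqnn subnn.
rewrite big1 ?addr0 => [/eqP|j ne_jm].
  by rewrite scaler_eq0 (negPf cm) (negPf (f0 (leq_ltn_trans (leq0n _) lt_mk))).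
rewrite iter_linZ (chain_iter _ fN) //.
have [le_mj|_] := leqP m j; last by rewrite scaler0.
suff /eqP -> : c j == 0 by rewrite scale0r.
apply: contraT => cj; have := max_m j; rewrite ltn_ord cj => /(_ isT) le_jm.
by move: ne_jm; rewrite -val_eqE /= eqn_leq le_mj le_jm.
Qed.

(** The chains that are bases of the generalized kernel, described by kernels of
    powers of [N] instead of coefficients; the equivalence is [chain_basisP].  If [k = 0], the third
    clause says that [N] is injective. *)
Definition full_chain (k : nat) (f : nat -> H) : Prop :=
  [/\ chain k f,
      (0 < k)%N -> f 0%N != 0,
      (forall x, N x = 0 -> exists a, x = if k is 0%N then 0 else a *: f 0%N) &
      (forall x, gker N x -> iter k N x = 0)].

(** By induction on [r]: [N x] is a combination of the first [r - 1] vectors;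
    the same combination of their successors differs from [x] by an element of
    [ker N], that is, by a multiple of [f 0]. *)
Lemma full_chain_span k f r x : full_chain k f -> (r <= k)%N ->
  iter r N x = 0 -> exists c : nat -> K, x = \sum_(i < r) c i *: f i.
Proof.
move=> [fN f0 kerN kN]; elim: r x => [|r IHr] x le_rk.
  by move=> /= ->; exists (fun=> 0); rewrite big_ord0.
rewrite iterSr => /(IHr _ (ltnW le_rk)) [c Nx].
have [] := kerN (x - \sum_(i < r) c i *: f i.+1).
  rewrite linearB linear_sum Nx; apply/eqP; rewrite subr_eq0; apply/eqP.
  apply: eq_bigr => i _; rewrite linearZ fN //.
  by apply: leq_trans le_rk; rewrite ltnS.
case: k le_rk {fN f0 kerN kN IHr} => // k _ a /eqP; rewrite subr_eq => /eqP ->.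
by exists (fun i => if i is i'.+1 then c i' else a); rewrite big_ord_recl.
Qed.

Lemma full_chain_surj k f r x : full_chain k f -> (r < k)%N ->
  iter r N x = 0 -> exists y, N y = x.
Proof.
move=> fN lt_rk /(full_chain_span fN (ltnW lt_rk)) [c ->].
exists (\sum_(i < r) c i *: f i.+1); rewrite linear_sum.
apply: eq_bigr => i _; rewrite linearZ; case: fN => [-> //].
by apply: leq_trans lt_rk; rewrite ltnS.
Qed.

(** The last vector of the chain [w] survives [N ^ (p - 1)], while [N ^ k] kills
    the whole generalized kernel. *)
Lemma chain_leq k f p w : full_chain k f -> chain p w ->
  ((0 < p)%N -> w 0%N != 0) -> (p <= k)%N.
Proof.
move=> [_ _ _ kN] wN; case: p wN => // p wN /(_ isT) w0.
rewrite ltnNge; apply: contra_neqN w0 => le_kp.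
have := chain_iter p wN (ltnSn p); rewrite leqnn subnn => <-.
by apply: (iter_lin_eq0 le_kp); apply: kN; apply: chain_gker wN _.
Qed.

Lemma full_chain_size k f k' f' : full_chain k f -> full_chain k' f' -> k = k'.
Proof.
move=> fN fN'; apply/eqP; rewrite eqn_leq; have [cf nf _ _] := fN.
have [cf' nf' _ _] := fN'.
by rewrite (chain_leq fN' cf nf) (chain_leq fN cf' nf').
Qed.

(** The first vector of [f'] lies in the line [ker N], so it spans this line:
    any chain of the right length with nonzero first vector is again full. *)
Lemma full_chain_eq k f f' : full_chain k f -> chain k f' ->
  ((0 < k)%N -> f' 0%N != 0) -> full_chain k f'.
Proof.
move=> [_ _ kerN kN] f'N f'0; split=> // x /kerN [a ->].
case: k kerN kN f'N f'0 => [|k] kerN kN f'N f'0; first by exists 0.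
have [a' f'E] := kerN _ (f'N 0%N isT).
have a'0 : a' != 0 by apply: contraNneq (f'0 isT) => a'0; rewrite f'E a'0 scale0r.
by exists (a / a'); rewrite f'E scalerA divfK.
Qed.

(** While the chain is shorter than [k], its last vector is in the range of
    [N] by [full_chain_surj], and any preimage prolongs it. *)
Lemma full_chain_extend k f p w : full_chain k f -> chain p w ->
  ((0 < p)%N -> w 0%N != 0) ->
  exists g, full_chain k g /\ forall i, (i < p)%N -> g i = w i.
Proof.
move=> fN wN w0; have le_pk := chain_leq fN wN w0.
case: p w wN w0 le_pk => [|p] w wN w0 le_pk; first by exists f.
move: le_pk => /subnKC; move: (k - p.+1)%N => d.
elim: d p w wN w0 => [|d IHd] p w wN w0 dE.
  by exists w; split=> //; apply: (full_chain_eq fN); rewrite -dE addn0.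
have lt_pk : (p.+1 < k)%N by rewrite -dE addnS ltnS leq_addr.
have [|y Ny] := full_chain_surj (x := w p) fN lt_pk.
  by rewrite (chain_iter _ wN) // ltnn.
pose w' i := if i == p.+1 then y else w i.
have [|||g [gN gw']] := IHd p.+1 w'.
- rewrite /w' => -[_|i]; first exact: wN.
  rewrite ltnS eqSS => le_ip; rewrite (ltn_eqF le_ip).
  have [->|ne_ip] := eqVneq i p; first by rewrite Ny.
  by apply: wN; rewrite ltnS ltn_neqAle ne_ip -ltnS.
- by [].
- by rewrite -dE addSnnS.
- exists g; split=> // i lt_ip; rewrite gw' ?ltnS 1?ltnW //.
  by rewrite /w' ltn_eqF.
Qed.

End OneMap.

(** * Maps that intertwine two operators up to a scalar *)

Section Intertwine.
Variables (N N' T : {linear H -> H}) (q : K).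
Hypothesis q0 : q != 0.
Hypothesis NT : forall x, N' (T x) = q *: T (N x).

Lemma intertwine_iter m x : iter m N' (T x) = q ^+ m *: T (iter m N x).
Proof.
elim: m => [|m IHm]; first by rewrite expr0 scale1r.
by rewrite iterS IHm linearZ /= NT scalerA -exprSr.
Qed.

Lemma intertwine_gker x : gker N x -> gker N' (T x).
Proof.
by move=> [m mx]; exists m; rewrite intertwine_iter mx linear0 scaler0.
Qed.

(** The vectors of a chain before [f (l - 1)] are images of it under powers of
    [N], and [ker T] is stable under [N]. *)
Lemma intertwine_vanish k f l i : chain N k f -> (l <= k)%N ->
  (forall a, a.+1 = l -> T (f a) = 0) -> (i < l)%N -> T (f i) = 0.
Proof.
case: l => // l fN lt_lk /(_ _ erefl) Tfl; rewrite ltnS => le_il.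
have := intertwine_iter (l - i) (f l); rewrite Tfl iter_lin0.
rewrite (chain_iter _ fN) // leq_subr subKn // => /esym/eqP.
by rewrite scaler_eq0 expf_eq0 (negPf q0) andbF => /eqP.
Qed.

(** [ker T] is stable under [N], and it meets [ker N], which is the line of
    [f 0], trivially. *)
Lemma intertwine_inj k f : full_chain N k f ->
  ((0 < k)%N -> T (f 0%N) <> 0) -> forall x, gker N x -> T x = 0 -> x = 0.
Proof.
move=> [_ _ kerN _] Tf0; apply: gker_kernel => [x Tx|x /kerN[a ->]].
  have := NT x; rewrite Tx linear0 => /esym/eqP.
  by rewrite scaler_eq0 (negPf q0) => /eqP.
case: k Tf0 {kerN} => // k /(_ isT) Tf0; rewrite linearZ => /eqP.
by rewrite scaler_eq0 => /orP[/eqP ->|/eqP //]; rewrite scale0r.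
Qed.

(** [N' ^ k] vanishes on the range of [T], hence everywhere on the generalized
    kernel of [N'], while the last vector of [f'] survives [N' ^ (k' - 1)]. *)
Lemma intertwine_surj_leq k f k' f' : full_chain N k f -> full_chain N' k' f' ->
  (forall y, gker N' y -> exists2 x, gker N x & T x = y) -> (k' <= k)%N.
Proof.
move=> [_ _ _ kN] [f'N f'0 _ _] Tsurj; case: k' f'N f'0 => // k' f'N /(_ isT) f'0.
rewrite ltnNge; apply: contra_neqN f'0 => le_kk'.
have [x Nx Tx] := Tsurj _ (chain_gker f'N (ltnSn k')).
have := chain_iter k' f'N (ltnSn k'); rewrite leqnn subnn => <-.
apply: (iter_lin_eq0 le_kk'); rewrite -Tx intertwine_iter kN //.
by rewrite linear0 scaler0.
Qed.

(** The factor [r ^ s] cancels the factor [q] that [N'] produces in passing from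
    [T (f (l + s))] to its predecessor; the chain stops at [s = 0] because [T]
    kills the vector of index [l - 1], or, if [l = 0], because [N] kills [f 0]. *)
Lemma intertwine_image_chain r k f l p : q * r = 1 -> chain N k f ->
  (l + p <= k)%N -> (forall a, a.+1 = l -> T (f a) = 0) ->
  chain N' p (fun s => r ^+ s *: T (f (l + s)%N)).
Proof.
move=> qr fN le_lpk Tfl [|i] lt_ip; rewrite linearZ /= NT scalerA.
  rewrite addn0 fN; last by rewrite (leq_trans _ le_lpk) // -addn1 leq_add2l.
  by case: l {le_lpk} Tfl => [|l] Tfl; rewrite ?linear0 ?Tfl // scaler0.
rewrite fN; last by rewrite (leq_trans _ le_lpk) // ltn_add2l.
by rewrite addnS exprSr -mulrA [r * q]mulrC qr mulr1.
Qed.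

End Intertwine.

End Nilpotent.

(** * Chains as bases *)

Section Basis.
Context {K : fieldType} {H : lmodType K}.

Lemma fsbig_fintype (I : finType) (F : I -> H) :
  \sum_(i \in [set: I]) F i = \sum_i F i.
Proof.
rewrite [RHS]fsbig_seq ?index_enum_uniq //; apply: eq_fsbigl.
by apply/seteqP; split=> // x _ /=; rewrite mem_index_enum.
Qed.

Lemma is_basis_finP (I : finType) (V : set H) (v : I -> H) :
  is_basis V v <-> (forall i, V (v i)) /\
    forall x, V x -> exists! c : I -> K, x = \sum_i c i *: v i.
Proof.
split=> -[Vv uV]; split=> // x /uV [c [xc c_uniq]]; exists c.
  move: xc; rewrite fsbig_fintype => -[_ xc]; split=> // d xd.
  by apply: c_uniq; rewrite fsbig_fintype; split=> //; exact: finite_finset.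
split=> [|d]; first by rewrite fsbig_fintype; split=> //; exact: finite_finset.
by rewrite fsbig_fintype => -[_ /c_uniq].
Qed.

Lemma is_basis_reindex (I J : choiceType) (h : I -> J) (V : set H) (v : J -> H) :
  bijective h -> is_basis V v -> is_basis V (v \o h).
Proof.
move=> bij_h [Vv uV]; have [g hK gK] := bij_h.
split=> [i|x /uV [c [[fin_c xc] c_uniq]]]; first exact: Vv.
exists (c \o h); split.
  split; last by rewrite xc (reindex_fsbigT h) //.
  rewrite (_ : [set i | _] = h @^-1` [set j | c j != 0]) //.
  by apply: finite_preimage => // i j _ _; apply: (can_inj hK).
move=> d [fin_d xd]; apply: funext => i /=.
suff -> : c = d \o g by rewrite /= hK.
apply: c_uniq; split.
  rewrite (_ : [set j | _] = g @^-1` [set i | d i != 0]) //.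
  by apply: finite_preimage => // j j' _ _; apply: (can_inj gK).
rewrite (reindex_fsbigT h) // xd; apply: eq_fsbigr => j _ /=.
by rewrite hK.
Qed.

Definition ext0 (V : zmodType) (k : nat) (x : 'I_k -> V) (i : nat) : V :=
  oapp x 0 (insub i).

Lemma ext0E (V : zmodType) k (x : 'I_k -> V) (i : 'I_k) : ext0 x i = x i.
Proof. by rewrite /ext0 valK. Qed.

Variable N : {linear H -> H}.

(** From a basis: comparing coefficients in [N y = 0] leaves only the first one,
    so [ker N] is the line of the first vector.  Conversely, a chain with nonzero
    first vector is independent by [chain_free] and spans by
    [full_chain_span] with [r = k]. *)
Lemma chain_basisP k (x : 'I_k -> H) :
  chain N k (ext0 x) /\ is_basis (gker N) x <-> full_chain N k (ext0 x).
Proof.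
split=> [[xN /is_basis_finP [Vx xu]]|xN].
  have indep (c : 'I_k -> K) : \sum_i c i *: x i = 0 -> c = fun=> 0.
    move=> c0; have [d [_ du]] := xu _ (gker0 N).
    rewrite -(du c) // -(du (fun=> 0)) //.
    by rewrite big1 // => i _; rewrite scale0r.
  have span y : gker N y -> exists c : nat -> K, y = \sum_(i < k) c i *: ext0 x i.
    move=> /xu [c [-> _]]; exists (ext0 c).
    by apply: eq_bigr => i _; rewrite !ext0E.
  split=> //.
  - case: k x xN Vx xu indep span => // k x xN Vx xu indep span _; apply/eqP => x0.
    suff /indep/(congr1 (@^~ ord0))/eqP :
      \sum_i (i == ord0)%:R *: x i = 0 by rewrite eqxx oner_eq0.
    rewrite (bigD1 ord0) //= -ext0E x0 scaler0 add0r big1 // => i /negPf ->.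
    by rewrite scale0r.
  - move=> y Ny; have [|c] := span y; first by exists 1%N.
    case: k x xN Vx xu indep span => [|k] x xN Vx xu indep span.
      by rewrite big_ord0; exists 0.
    move=> yc; exists (c 0%N); move: Ny.
    (* the coefficients of N y: those of y shifted by one place *)
    pose d i := if (i < k)%N then c i.+1 else 0.
    have Nyd : N y = \sum_(i < k.+1) d i *: x i.
      rewrite yc big_ord_recl linearD linearZ /= xN // scaler0 add0r linear_sum.
      rewrite big_ord_recr /= {2}/d ltnn scale0r addr0.
      apply: eq_bigr => i _; rewrite linearZ /= xN; last exact: ltn_ord.
      rewrite ?lift0 /d /= ltn_ord; congr (_ *: _).
      by rewrite -(ext0E x (widen_ord _ _)).
    rewrite Nyd => /indep d0; rewrite yc big_ord_recl /= big1 ?addr0 //.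
    move=> i _; have := congr1 (@^~ (widen_ord (leqnSn k) i)) d0.
    by rewrite /d /= ltn_ord => ->; rewrite scale0r.
  - move=> y /span [c ->]; rewrite iter_lin_sum big1 // => i _.
    by rewrite iter_linZ (chain_iter _ xN) // leqNgt ltn_ord scaler0.
have [cx x0 _ kN] := xN; split=> //; apply/is_basis_finP; split.
  by move=> i; rewrite -ext0E; apply: chain_gker cx _.
move=> y /kN /(full_chain_span xN (leqnn k)) [c yc].
exists (fun i : 'I_k => c i); split.
  by rewrite yc; apply: eq_bigr => i _; rewrite ext0E.
move=> d yd; apply: funext.
move=> i; apply/eqP; rewrite -(ext0E d) -subr_eq0; apply/eqP.
apply: (chain_free cx x0 (c := fun i => c i - ext0 d i)) => //.
under eq_bigr do rewrite scalerBl.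
rewrite big_split /= -yc sumrN yd; apply/eqP; rewrite subr_eq0; apply/eqP.
by apply: eq_bigr => {}i _; rewrite !ext0E.
Qed.

End Basis.

(** * Generalized eigenspaces and Jordan parts *)

Section Jordan.
Context {K : fieldType} {H : lmodType K}.

Definition eigen_shift (S : {linear H -> H}) (beta : K) (y : H) : H :=
  S y - beta *: y.

Section ShiftLinear.
Variables (S : {linear H -> H}) (beta : K).

Lemma eigen_shift_linear : linear (eigen_shift S beta).
Proof.
move=> a x y; rewrite /eigen_shift linearP scalerBr scalerDr opprD !scalerA.
by rewrite mulrC addrACA.
Qed.

HB.instance Definition _ :=
  GRing.isLinear.Build K H H *:%R (eigen_shift S beta) eigen_shift_linear.

End ShiftLinear.

Variable S : {linear H -> H}.

Lemma gen_eigenspace0 beta : gen_eigenspace S beta 0.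
Proof. exact: (gker0 (eigen_shift S beta)). Qed.

Lemma gen_eigenspace_stable beta x :
  gen_eigenspace S beta x -> gen_eigenspace S beta (S x).
Proof.
move=> Vx; rewrite (_ : S x = eigen_shift S beta x + beta *: x).
  exact: (gkerD (gker_apply (N := eigen_shift S beta) Vx)
                (gkerZ (N := eigen_shift S beta) beta Vx)).
by rewrite /eigen_shift subrK.
Qed.

(** On an eigenvector for [mu] the operator [S - beta] is multiplication by
    [mu - beta <> 0], which is not nilpotent. *)
Lemma gen_eigenspace_eigenvector beta mu x : mu != beta ->
  gen_eigenspace S beta x -> S x = mu *: x -> x = 0.
Proof.
move=> ne; move: x.
apply: (gker_kernel (N := eigen_shift S beta)) => [x Sx|x].
  rewrite /eigen_shift linearB !linearZ /= Sx linearZ /= Sx scalerBr scalerA.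
  by rewrite scalerN Sx !scalerA [beta * mu]mulrC.
move=> + Sx; rewrite /= /eigen_shift Sx -scalerBl => /eqP; rewrite scaler_eq0.
by rewrite subr_eq0 (negPf ne) => /eqP.
Qed.

Lemma gen_eigenspace_trivial beta : ~ is_eigenvalue S beta ->
  forall x, gen_eigenspace S beta x -> x = 0.
Proof.
move=> noeig x Vx; apply: (gker_kernel (N := eigen_shift S beta)
  (P := fun=> True)) Vx _ => // {}x /eqP + _.
rewrite subr_eq0 => /eqP Sx; apply/eqP; apply: contraT => x0.
by case: noeig; exists x.
Qed.

Lemma jordan_chainP beta k (x : 'I_k -> H) :
  jordan_chain S beta x <-> chain (eigen_shift S beta) k (ext0 x).
Proof.
split=> [[x0 xS] [|i] lt_ik|xN].
- by rewrite (ext0E x (Ordinal lt_ik)); apply: x0.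
- rewrite (ext0E x (Ordinal lt_ik)) (ext0E x (Ordinal (ltnW lt_ik))).
  exact: xS.
- split=> [a a0|a b ba]; have := xN _ (ltn_ord _).
    by move=> /(_ a); rewrite ext0E a0.
  by move=> /(_ b); rewrite ext0E ba ext0E.
Qed.

Lemma jordan_chain_basisP beta k (x : 'I_k -> H) :
  jordan_chain_basis S beta x <-> full_chain (eigen_shift S beta) k (ext0 x).
Proof.
by rewrite -chain_basisP /jordan_chain_basis jordan_chainP.
Qed.

(** With a single block, the dependent pairs indexing the Jordan basis are the
    positions in that block. *)
Lemma only_block_full_chain beta (J : jordan_part H) (c : jidx J) :
  is_jordan_part S beta J -> only_block c ->
  full_chain (eigen_shift S beta) (jlen c) (ext0 (@jvec K H J c)).
Proof.
move=> [_ Jchain Jbasis] cE; apply/jordan_chain_basisP; split; first exact: Jchain.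
pose h (i : 'I_(jlen c)) : {b : jidx J & 'I_(jlen b)} :=
  Tagged (fun b : jidx J => 'I_(jlen b)) i.
apply: (is_basis_reindex (h := h)) Jbasis.
exists (fun t => cast_ord (congr1 (@jlen K H J) (cE (tag t))) (tagged t)).
  by move=> i; apply: val_inj.
move=> [b i] /=; have bc := cE b; subst b.
by congr existT; apply: val_inj.
Qed.

End Jordan.

(** * Blocks with respect to a direct sum decomposition *)

Section Decomposition.
Context {K : fieldType} {H : lmodType K}.
Variables (n : nat) (V : 'I_n -> set H).

Lemma component_unique (u : 'I_n -> H) : decomposition V ->
  (forall a, V a (u a)) -> component V (\sum_a u a) = u.
Proof.
move=> decV Vu; apply: xget_unique => // v [Vv uv].
have [w [_ w_uniq]] := decV (\sum_a u a).
by rewrite -(w_uniq u) // -(w_uniq v).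
Qed.

Hypotheses (decV : decomposition V) (V0 : forall a, V a 0).

Lemma component_in b x a : V b x -> component V x a = if a == b then x else 0.
Proof.
move=> Vx; pose u a := if a == b then x else 0.
rewrite -[RHS]/(u a).
have <- : component V (\sum_a u a) a = u a.
  by rewrite component_unique // => a'; rewrite /u; case: eqVneq => [->|].
by rewrite -big_mkcond big_pred1_eq.
Qed.

Lemma block_in (A : H -> H) a b b' x : (forall y, V b y -> V b' (A y)) ->
  V b x -> block V A a b x = if a == b' then A x else 0.
Proof. by move=> AV /AV Ax; rewrite /block (component_in _ Ax). Qed.

Lemma block_zero_in (A : H -> H) a b b' : (forall y, V b y -> V b' (A y)) ->
  a != b' -> block_zero V A a b.
Proof. by move=> AV /negPf ne x Vx; rewrite (block_in _ AV) // ne. Qed.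

Lemma decomposition_reindex (r : 'I_n -> 'I_n) : bijective r ->
  decomposition (V \o r).
Proof.
move=> bij_r x; have [s rK sK] := bij_r; have [u [[Vu xu] u_uniq]] := decV x.
exists (u \o r); split.
  by split=> [a|]; [apply: Vu|rewrite xu (reindex r) //; apply: onW_bij].
move=> v [Vv xv]; rewrite (u_uniq (v \o s)).
  by apply: funext => a /=; rewrite rK.
split=> [a|]; first by have := Vv (s a); rewrite /= sK.
rewrite xv [RHS](reindex r) /=; last exact: onW_bij.
by apply: eq_bigr => a _; rewrite rK.
Qed.

(** Each component of an eigenvector for [mu] is zero or an eigenvector for [mu],
    because the summands are stable under [S]; it vanishes unless [mu] is the
    eigenvalue of its summand. *)
Lemma eigenvalue_in (S : {linear H -> H}) (mu : K) (lam : 'I_n -> K) :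
  (forall a, V a = gen_eigenspace S (lam a)) ->
  is_eigenvalue S mu -> exists a, lam a = mu.
Proof.
move=> VE [x x0 Sx]; apply: contrapT => no_a; move/eqP: x0; apply.
have [u [[Vu xu] _]] := decV x.
have ne a : mu != lam a by apply/eqP => mua; apply: no_a; exists a.
rewrite xu big1 // => a _; move: (Vu a); rewrite VE => Vua.
apply: (gen_eigenspace_eigenvector (ne a) Vua).
have [w [_ w_uniq]] := decV (S x).
have Su : w = fun b => S (u b).
  apply: w_uniq; split=> [b|]; last by rewrite xu linear_sum.
  by rewrite VE; apply: gen_eigenspace_stable; rewrite -VE.
have muu : w = fun b => mu *: u b.
  apply: w_uniq; split=> [b|]; last by rewrite Sx xu scaler_sumr.
  rewrite VE; apply: (gkerZ (N := eigen_shift S (lam b))).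
  by have := Vu b; rewrite VE.
by have := congr1 (@^~ a) muu; rewrite Su.
Qed.

End Decomposition.

(** * The block of T between two single Jordan blocks *)

Section JordanBlockForm.
Context {K : numClosedFieldType} {H : lmodType K}.
Variables (S T : {linear H -> H}) (q beta : K).
Hypothesis qqC : q * q^* = 1.
Hypothesis hST : forall x, S (T x) = q *: T (S x).

Let q0 : q != 0.
Proof. by apply/eqP => q0; move/eqP: qqC; rewrite q0 mul0r eq_sym oner_eq0. Qed.

Lemma eigen_shift_intertwine x :
  eigen_shift S (q * beta) (T x) = q *: T (eigen_shift S beta x).
Proof.
rewrite /eigen_shift hST [T (_ - _)]linearB [T (_ *: x)]linearZ /=.
by rewrite scalerBr scalerA.
Qed.

Lemma qcommute_gen_eigenspace x :
  gen_eigenspace S beta x -> gen_eigenspace S (q * beta) (T x).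
Proof.
exact: (intertwine_gker (N := eigen_shift S beta)
         (N' := eigen_shift S (q * beta)) eigen_shift_intertwine).
Qed.

Variables (l p : nat) (x : 'I_(l + p) -> H).
Hypothesis xS : jordan_chain_basis S beta x.
Hypothesis xl : last_vanishing T x l.

Let N : {linear H -> H} := eigen_shift S beta.
Let N' : {linear H -> H} := eigen_shift S (q * beta).

Let xN : full_chain N (l + p) (ext0 x).
Proof. exact/jordan_chain_basisP. Qed.

Let Vx i : gen_eigenspace S beta (x i).
Proof. by case: xS => _ []. Qed.

Let Tx0 a : (a < l)%N -> T (ext0 x a) = 0.
Proof.
have [cx _ _ _] := xN; have [_ xl0 _] := xl.
apply: (intertwine_vanish (N' := N') q0 eigen_shift_intertwine cx (leq_addr p l)).
move=> b bl; have lt_bk : (b < l + p)%N by rewrite -bl leq_addr.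
by rewrite (ext0E x (Ordinal lt_bk)); apply: xl0.
Qed.

Let Txl : (0 < p)%N -> T (ext0 x l) != 0.
Proof.
move=> p0; have [_ _ xl1] := xl.
have lt_lk : (l < l + p)%N by rewrite -addn1 leq_add2l.
by apply/eqP; rewrite (ext0E x (Ordinal lt_lk)); apply: xl1 => /=.
Qed.

(** The images of the [x]'s beyond the first [l] form a chain with nonzero first
    vector, which is prolonged to a full one; the [y]'s are the vectors added. *)
Lemma image_chain_extend : (exists m z, full_chain N' m z) ->
  exists (j : nat) (y : 'I_j -> H),
    jordan_chain_basis S (q * beta) (image_chain q T x y).
Proof.
move=> [m [z zN']]; have [cx _ _ _] := xN.
pose w s := q^* ^+ s *: T (ext0 x (l + s)%N).
have wN' : chain N' p w.
  apply: (intertwine_image_chain eigen_shift_intertwine qqC cx (leqnn _)).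
  by move=> a al; apply: Tx0; rewrite -al.
have w0 : (0 < p)%N -> w 0%N != 0.
  by rewrite /w expr0 scale1r addn0.
have le_pm := chain_leq zN' wN' w0.
have [g [gN' gw]] := full_chain_extend zN' wN' w0.
move: gN'; rewrite -(subnKC le_pm); move: (m - p)%N => d gN'.
pose y (t : 'I_d) := g (p + t)%N; exists d, y; apply/jordan_chain_basisP.
suff imE i : (i < p + d)%N -> ext0 (image_chain q T x y) i = g i.
  have [cg g0 _ _] := gN'; apply: (full_chain_eq gN') => [i lt_i|m0]; last first.
    by rewrite imE // g0.
  by rewrite imE // cg //; case: i lt_i => // i lt_i; rewrite imE // ltnW.
move=> lt_i; rewrite (ext0E _ (Ordinal lt_i)) /image_chain.
case: splitP => [s /= ->|t /= -> //].
by rewrite gw // /w -(ext0E x).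
Qed.

Variable Ti : H -> H.
Hypothesis TiE : forall u, gen_eigenspace S beta u -> Ti u = T u.

Lemma image_chain_matrix j (y : 'I_j -> H) :
  is_matrix_of Ti x (image_chain q T x y) (corner_mx q l p j).
Proof.
move=> c; rewrite TiE; last exact: Vx.
rewrite big_split_ord /= [X in _ + X]big1 ?addr0 => [|t _]; last first.
  rewrite -(fintype.splitK c); case: (fintype.split c) => s /=.
    by rewrite /corner_mx block_mxEdl mxE scale0r.
  by rewrite /corner_mx block_mxEdr mxE scale0r.
rewrite -(fintype.splitK c); case: (fintype.split c) => s /=.
  rewrite big1 => [|t _]; last by rewrite /corner_mx block_mxEul mxE scale0r.
  by rewrite -ext0E Tx0 //= ltn_ord.
rewrite (bigD1 s) //= big1 ?addr0 => [|t /negPf ne_ts]; last first.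
  by rewrite /corner_mx block_mxEur !mxE ne_ts mulr0n scale0r.
rewrite /corner_mx block_mxEur !mxE eqxx mulr1n /image_chain.
case: splitP => [s' /= /val_inj <-|t /= st].
  by rewrite scalerA -exprMn qqC expr1n scale1r.
by have := ltn_ord s; rewrite st ltnNge leq_addr.
Qed.

(** If [0 < l], the first vector of the chain is a nonzero element of the
    kernel; if [l = 0], then [T] does not kill the first vector. *)
Lemma corner_injective :
  (forall u, gen_eigenspace S beta u -> Ti u = 0 -> u = 0) <-> l = 0%N.
Proof.
have [cx x0 _ _] := xN; split=> [Tinj|l0 u Vu].
  apply/eqP; apply: contraT; rewrite -lt0n => l_gt0.
  have lp_gt0 : (0 < l + p)%N by rewrite addn_gt0 l_gt0.
  have Vx0 : gen_eigenspace S beta (ext0 x 0%N) := chain_gker cx lp_gt0.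
  by have := x0 lp_gt0; rewrite (Tinj _ Vx0) ?eqxx // TiE // Tx0.
rewrite TiE //; apply: (intertwine_inj q0 eigen_shift_intertwine xN) Vu.
have <- : ext0 x l = ext0 x 0%N by congr (ext0 x _).
by rewrite {1}l0 => /Txl/eqP.
Qed.

(** Surjectivity bounds the length [p + j] of the target chain by the length
    [l + p] of the source chain, and injectivity is [l = 0]. *)
Lemma corner_bijective j (y : 'I_j -> H) :
  jordan_chain_basis S (q * beta) (image_chain q T x y) ->
  set_bij (gen_eigenspace S beta) (gen_eigenspace S (q * beta)) Ti <->
  l = 0%N /\ (p + j = l + p)%N.
Proof.
move=> /[dup] wS /jordan_chain_basisP wN'; split=> [[_ Tinj Tsurj]|[l0 pj]].
  have l0 : l = 0%N.
    apply/corner_injective => u Vu Tu; have V0 := gen_eigenspace0 S beta.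
    apply: Tinj; rewrite ?inE //.
    by rewrite Tu TiE // linear0.
  split=> //; apply/eqP; rewrite eqn_leq {2}l0 leq_addr andbT.
  apply: (intertwine_surj_leq eigen_shift_intertwine xN wN') => v /Tsurj[u Vu <-].
  by exists u => //; rewrite TiE.
split=> [u Vu|u v|v Vv].
- by rewrite TiE //; apply: qcommute_gen_eigenspace.
- rewrite !inE => Vu Vv; rewrite !TiE // => Tuv; apply/eqP; rewrite -subr_eq0.
  have Vuv : gen_eigenspace S beta (u - v).
    by rewrite -scaleN1r; apply: (gkerD (N := N)) => //; apply: (gkerZ (N := N)).
  apply/eqP; apply: (corner_injective.2 l0) => //.
  by rewrite TiE // linearB Tuv subrr.
(* p + j = l + p with l = 0 leaves no y, so the images of x span *)
have {pj} j0 : j = 0%N by apply/eqP; rewrite -(eqn_add2l p) pj l0 addn0.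
have [_ /is_basis_finP [_ /(_ v Vv) [c [vc _]]]] := wS.
pose u := \sum_i c (lshift j i) *: (q^* ^+ i *: x (rshift l i)).
have Vu : gen_eigenspace S beta u.
  apply: (gker_sum (N := N)) => i.
  by apply: (gkerZ (N := N)); apply: (gkerZ (N := N)); apply: Vx.
exists u => //; rewrite TiE //.
rewrite vc big_split_ord /= [X in _ + X]big1 ?addr0; last first.
  by move=> t _; have := ltn_ord t; rewrite {2}j0.
rewrite linear_sum; apply: eq_bigr => i _; rewrite !linearZ /= /image_chain.
case: splitP => [s' /= /val_inj <- //|t /= st].
by have := ltn_ord i; rewrite st ltnNge leq_addr.
Qed.

End JordanBlockForm.

(** * Rotation of the indices and the block form of T *)

Lemma ord_rot_bij (n i : nat) : bijective (@ord_rot n i).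
Proof.
apply: injF_bij => a b /(congr1 val) /= /eqP.
by rewrite eqn_modDl !modn_small // => /eqP /val_inj.
Qed.

Lemma ord_rot_ordS (n i : nat) (a : 'I_n) : ord_rot i (ordS a) = ordS (ord_rot i a).
Proof. by apply: val_inj; rewrite /= modnDmr addnS -addn1 -[in RHS]addn1 modnDml. Qed.

Theorem corollary4p7 (R : realType) (H : completeNormedModType R[i])
    (ip : {dot H for Num.conj}) (hip : forall x : H, `|x| ^+ 2 = ip x x)
    (S T : {linear H -> H}) (hS : bounded_operator S) (hT : bounded_operator T)
    (q : R[i]) (hq : `|q| = 1) (hq1 : q != 1)
    (hST : forall x, S (T x) = q *: T (S x))
    (alpha : R[i]) (halpha : alpha != 0) (heig : is_eigenvalue S alpha)
    (n : nat) (hn : (0 < n)%N)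
    (hqi : forall i : nat, (0 < i < n)%N -> q ^+ i != 1)
    (J : 'I_n -> jordan_part H)
    (hJ : jordan_diag S (fun a : 'I_n => q ^+ a * alpha) J) :
  let lam := fun a : 'I_n => q ^+ a * alpha in
  let V := fun a : 'I_n => gen_eigenspace S (lam a) in
  (q ^+ n != 1 ->
     [/\ ~ is_eigenvalue S (q^* * alpha),
         ~ is_eigenvalue S (q ^+ n * alpha) &
         forall a b : 'I_n, a <> b.+1 :> nat -> block_zero V T a b])
  /\
  (q ^+ n = 1 ->
     (forall a b : 'I_n, a <> ordS b -> block_zero V T a b) /\
     (forall b : 'I_n, block_zero V T (ordS b) b ->
        let rot := @ord_rot n b.+1 in
        let V' := fun a : 'I_n => V (rot a) in
        [/\ jordan_diag S (fun a => lam (rot a)) (fun a => J (rot a)),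
            (forall a c : 'I_n, a <> ordS c -> block_zero V' T a c) &
            (forall a c : 'I_n, a = 0%N :> nat -> c.+1 = n ->
               [/\ V' a = V (ordS b), V' c = V b,
                   (forall x, V b x -> block V' T a c x = block V T (ordS b) b x) &
                   block_zero V' T a c])]))
  /\
  (forall b : 'I_n, ((b.+1 < n)%N \/ q ^+ n = 1) ->
     forall (c : jidx (J b)) (c' : jidx (J (ordS b))),
     only_block c -> only_block c' ->
     forall (l p : nat) (x : 'I_(l + p) -> H),
     jordan_chain_basis S (q ^+ b * alpha) x ->
     last_vanishing T x l ->
     let Ti := block V T (ordS b) b in
     (exists (j : nat) (y : 'I_j -> H),
        jordan_chain_basis S (q ^+ b.+1 * alpha) (image_chain q T x y)) /\
     (forall (j : nat) (y : 'I_j -> H),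
        jordan_chain_basis S (q ^+ b.+1 * alpha) (image_chain q T x y) ->
        [/\ is_matrix_of Ti x (image_chain q T x y) (corner_mx q l p j),
            (forall u, V b u -> Ti u = 0 -> u = 0) <-> l = 0%N,
            set_bij (V b) (V (ordS b)) Ti <-> l = 0%N /\ (p + j = l + p)%N &
            (p + j = l + p)%N -> jlen c = jlen c'])).
Proof.
move=> lam V; have [decV _ partJ] := hJ.
have V0 a : V a 0 := gen_eigenspace0 S (lam a).
have qqC : q * q^* = 1 by rewrite -normCK hq expr1n.
have q0 : q != 0 by rewrite -normr_gt0 hq ltr01.
have q_inj i j : (i < j)%N -> (j - i < n)%N -> q ^+ i != q ^+ j.
  move=> lt_ij lt_n; rewrite -(subnKC (ltnW lt_ij)) exprD.
  rewrite -subr_eq0 -{1}[q ^+ i]mulr1 -mulrBr mulf_neq0 ?expf_neq0 //.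
  by rewrite subr_eq0 eq_sym hqi // subn_gt0 lt_ij.
have lamS (b : 'I_n) : q ^+ b.+1 * alpha = q * lam b by rewrite exprS mulrA.
have lam_ordS (b : 'I_n) : (b.+1 < n)%N \/ q ^+ n = 1 -> lam (ordS b) = q * lam b.
  rewrite -lamS /lam /=; case=> [lt_bn|qn]; first by rewrite modn_small.
  by rewrite expr_mod.
have TV (b : 'I_n) : (b.+1 < n)%N \/ q ^+ n = 1 ->
    forall x, V b x -> V (ordS b) (T x).
  move=> hb x; rewrite /V (lam_ordS b hb).
  exact: qcommute_gen_eigenspace hST x.
split; [move=> qn|split].
- have noeig mu : (forall a : 'I_n, lam a != mu) -> ~ is_eigenvalue S mu.
    move=> ne_mu /(eigenvalue_in decV (fun=> erefl)) [a lam_a].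
    by have := ne_mu a; rewrite /lam lam_a eqxx.
  have noeign : ~ is_eigenvalue S (q ^+ n * alpha).
    apply: noeig => a; rewrite /lam (inj_eq (mulIf halpha)).
    case: a => -[|a] lt_an /=; first by rewrite eq_sym.
    by rewrite q_inj // ltn_subrL.
  split=> //.
    (* q^a = conj q would give q^(a+1) = 1 with a + 1 <= n *)
    apply: noeig => a; rewrite /lam (inj_eq (mulIf halpha)).
    apply/eqP => qa; have : q ^+ a.+1 = 1 by rewrite exprS qa.
    have := ltn_ord a; rewrite leq_eqVlt => /orP[/eqP ->|lt_an]; apply/eqP => //.
    exact: hqi.
  move=> a b ab; have [lt_bn|le_nb] := ltnP b.+1 n.
    apply: (block_zero_in decV V0 (TV b (or_introl lt_bn))).
    by apply/eqP => /(congr1 val) /=; rewrite modn_small.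
  have bn : b.+1 = n by apply/eqP; rewrite eqn_leq le_nb ltn_ord.
  have T0 x : V b x -> T x = 0.
    move=> /(qcommute_gen_eigenspace hST); rewrite -lamS bn.
    exact: gen_eigenspace_trivial.
  have TVb y : V b y -> V b (T y) by move=> /T0 ->.
  by move=> x Vx; rewrite (block_in decV V0 _ TVb) // T0 // if_same.
- move=> qn; have TVn b := TV b (or_intror qn).
  split=> [a b ab|b Tb0 rot V'].
    by apply: (block_zero_in decV V0 (TVn b)); apply/eqP.
  have rot_bij : bijective rot := @ord_rot_bij n b.+1.
  have decV' : decomposition V' := decomposition_reindex decV rot_bij.
  have V'0 a : V' a 0 by apply: V0.
  have TV' a x : V' a x -> V' (ordS a) (T x).
    by move=> /TVn; rewrite /V' /rot ord_rot_ordS.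
  split=> [|a c ac|a c a0 cn].
  + split=> [//|a c ac|a]; last exact: partJ.
    have SV' y : V' c y -> V' c (S y) := @gen_eigenspace_stable _ _ S _ y.
    exact: (block_zero_in decV' V'0 SV').
  + by apply: (block_zero_in decV' V'0 (TV' c)); apply/eqP.
  have rota : rot a = ordS b by apply: val_inj; rewrite /= a0 addn0.
  have rotc : rot c = b.
    by apply: val_inj; rewrite /= addSnnS cn modnDr modn_small.
  have ac : a = ordS c by apply: val_inj; rewrite /= cn modnn.
  have blockE x : V b x -> block V' T a c x = block V T (ordS b) b x.
    move=> Vx; rewrite (block_in decV V0 _ (TVn b)) // eqxx.
    by rewrite (block_in decV' V'0 _ (TV' c)) ?ac ?eqxx // /V' rotc.
  split=> //; rewrite /V' ?rota ?rotc // => x.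
  by rewrite rotc => Vx; rewrite blockE // Tb0.
move=> b hb c c' cE c'E l p x xS xl Ti.
have TiE u : V b u -> Ti u = T u.
  by move=> Vu; rewrite /Ti (block_in decV V0 _ (TV b hb)) // eqxx.
have fullc := only_block_full_chain (partJ b) cE.
have fullc' := only_block_full_chain (partJ (ordS b)) c'E.
rewrite -/(lam (ordS b)) lam_ordS // in fullc'; rewrite lamS.
split.
  apply: (image_chain_extend qqC hST xS xl).
  by exists (jlen c'), (ext0 (@jvec _ _ _ c')).
move=> j y yS; split.
- exact: (image_chain_matrix qqC hST xS xl TiE).
- exact: (corner_injective qqC hST xS xl TiE).
- rewrite [V (ordS b)](_ : _ = gen_eigenspace S (q * lam b)); last first.
    by rewrite /V lam_ordS.
  exact: (corner_bijective qqC hST xS xl TiE yS).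
- move=> pj; rewrite (full_chain_size fullc (iffLR (jordan_chain_basisP _ _ _) xS)).
  by rewrite (full_chain_size fullc' (iffLR (jordan_chain_basisP _ _ _) yS)).
Qed.
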